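(* Let $G$ be an $n$-vertex graph, where $n$ is odd. If $\delta(G) \geq \max\{2\tilde{\alpha}(G) + 9, \tilde{\alpha}(G) + 18\}$, then $\mathcal{C}_n(G) = \mathcal{C}(G)$.
   Context: Graphs are finite and simple. $\delta(G)$ is the minimum degree of $G$. The bipartite independence number $\tilde{\alpha}(G)$ of $G$ is the smallest integer $k$ for which there exist positive integers $a$ and $b$ such that $a + b = k + 1$, and there is at least one edge of $G$ between $A$ and $B$ whenever $A \subseteq V(G)$ and $B \subseteq V(G) \setminus A$ are sets of sizes $|A| = a$ and $|B| = b$. The cycle space $\mathcal{C}(G)$ is the vector space over $\mathbb{F}_2$ spanned by the incidence vectors (in $\mathbb{F}_2^{E(G)}$) of the edge-sets of all cycles of $G$. If $G$ has $n$ vertices, $\mathcal{C}_n(G)$ is the subspace of $\mathcal{C}(G)$ spanned by the incidence vectors of the edge-sets of cycles of length $n$ in $G$, i.e. of Hamilton cycles of $G$. *)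

(* Defs.v *)
From HB Require Import structures.
From mathcomp Require Import all_boot all_order all_algebra.

Set Implicit Arguments.
Unset Strict Implicit.
Unset Printing Implicit Defensive.

Import GRing.Theory.

Record sgraph := SGraph {
  vertex :> finType;
  adj : rel vertex;
  adj_sym : symmetric adj;
  adj_irrefl : irreflexive adj }.

Section Graph.
Variable G : sgraph.

Definition degree (x : G) : nat := #|[set y | adj x y]|.

(* The default value #|G| exceeds every degree, so it is only attained on the
   graph with no vertices. *)
Definition min_degree : nat := \big[minn/#|G|]_(x : G) degree x.

Definition bip_pair (a b : nat) : bool :=
  [forall A : {set G}, forall B : {set G},
    [&& B \subset ~: A, #|A| == a & #|B| == b] ==>
    [exists x in A, exists y in B, adj x y]].

(* a, b <= k is forced by a + b = k + 1 and a, b > 0. *)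
Definition bip_indep_bound (k : nat) : bool :=
  [exists a : 'I_k.+1, exists b : 'I_k.+1,
    [&& 0 < a, 0 < b, a + b == k.+1 & bip_pair a b]].

Lemma bip_indep_boundP k :
  reflect (exists a b : nat, [/\ 0 < a, 0 < b, a + b = k.+1 &
             forall A B : {set G}, B \subset ~: A -> #|A| = a -> #|B| = b ->
             exists x y, [/\ x \in A, y \in B & adj x y]])
          (bip_indep_bound k).
Proof.
apply: (iffP existsP) => [[a /existsP[b /and4P[a0 b0 /eqP ab /forallP H]]]|].
  exists a, b; split=> // A B sBA cA cB.
  have /forallP/(_ B) := H A.
  rewrite sBA cA cB !eqxx /= => /existsP[x /andP[xA /existsP[y /andP[yB xy]]]].
  by exists x, y.
move=> [a [b [a0 b0 ab H]]].
have ak : a < k.+1 by rewrite -ab -[X in X < _]addn0 ltn_add2l.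
have bk : b < k.+1 by rewrite -ab -[X in X < _]add0n ltn_add2r.
exists (Ordinal ak); apply/existsP; exists (Ordinal bk).
apply/and4P; split=> //=; first exact/eqP.
apply/forallP=> A; apply/forallP=> B; apply/implyP=> /and3P[sBA /eqP cA /eqP cB].
have [x [y [xA yB xy]]] := H A B sBA cA cB.
by apply/existsP; exists x; rewrite xA; apply/existsP; exists y; rewrite yB.
Qed.

Lemma bip_indep_bound_ex : exists k, bip_indep_bound k.
Proof.
exists #|G|.+1; apply/bip_indep_boundP; exists 1, #|G|.+1; split=> // A B _ _ cB.
by have := max_card (mem B); rewrite cB ltnn.
Qed.

Definition bip_indep_number : nat := ex_minn bip_indep_bound_ex.

Definition edges : {set {set G}} :=
  [set [set p.1; p.2] | p : G * G & adj p.1 p.2].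

Definition edge : finType := {f : {set G} | f \in edges}.

Definition edge_space : vectType 'F_2 := {ffun edge -> ('F_2)^o}.

Definition incidence (F : {set {set G}}) : edge_space :=
  [ffun f : edge => ((val f \in F)%:R : ('F_2)^o)%R].

Definition is_cycle (s : seq G) : bool := (2 < size s) && ucycleb (@adj G) s.

Definition cycle_edges (s : seq G) : {set {set G}} :=
  [set [set x; next s x] | x in s].

Definition cycles_of_length (k : nat) : {set {set {set G}}} :=
  [set cycle_edges s | s : k.-tuple G & is_cycle s].

(* A cycle has no repeated vertex, so its length is at most #|G|; see
   [all_cyclesP]. *)
Definition all_cycles : {set {set {set G}}} :=
  \bigcup_(k < #|G|.+1) cycles_of_length k.

Lemma all_cyclesP F :
  reflect (exists2 s, is_cycle s & F = cycle_edges s) (F \in all_cycles).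
Proof.
apply: (iffP bigcupP) => [[k _ /imsetP[s]]|[s cs ->]].
  by rewrite inE => cs ->; exists s.
have us : uniq s by case/andP: cs => _ /andP[].
have ks : size s < #|G|.+1 by rewrite ltnS -(card_uniqP us) max_card.
exists (Ordinal ks) => //=; apply/imsetP.
by exists (in_tuple s); rewrite ?inE.
Qed.

Lemma cycle_edges_sub s : is_cycle s -> cycle_edges s \subset edges.
Proof.
case/andP=> _ /andP[cs _]; apply/subsetP=> _ /imsetP[x xs ->].
by apply/imsetP; exists (x, next s x); rewrite ?inE //= next_cycle.
Qed.

Definition cycle_space : {vspace edge_space} :=
  <<[seq incidence F | F in all_cycles]>>%VS.

Definition cycle_space_of_length (k : nat) : {vspace edge_space} :=
  <<[seq incidence F | F in cycles_of_length k]>>%VS.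

End Graph.

(* Main.v *)
Require Import Defs.
From mathcomp Require Import all_boot all_order all_algebra.
From mathcomp Require Import zify.

Set Implicit Arguments.
Unset Strict Implicit.
Unset Printing Implicit Defensive.

Import GRing.Theory.

(** Write k for the bipartite independence number; it is witnessed by a and b with a
+ b = k + 1 such that disjoint vertex sets of sizes a and b are always joined by an
edge. If the Hamilton cycles did not span the cycle space, a linear functional over
F_2 would kill them all but not some cycle ([separating_functional]). Such a
functional is a 0/1 weighting f of the edges for which every Hamilton cycle has even
weight, so it suffices to show that then every cycle has even weight
([closed_walk_even]).

Hamilton cycles are abundant: by the rotation argument of McDiarmid and Yolov, as
long as every vertex keeps k neighbours outside the ends of some prescribed edges,
there is a Hamilton cycle through these edges, provided that some cyclic order of
the vertices contains them all ([hamilton_cycle_through]). The surplus 18 in the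
degree condition makes this applicable after deleting a few vertices. Take a cycle C
= x1 x2 x3 x4 ... xl with l <= 7, and for every vertex xi of C other than x1 and x3
a triangle xi ai bi, all of them disjoint. A Hamilton cycle of G - {x4, ..., xl}
through x1 x2 x3 and through the edges ai bi gives rise to Hamilton cycles of G in
two ways. Either insert each of x4, ..., xl in its edge ai bi; or replace the detour
x1 x2 x3 by the rest of C and insert x2 in its edge a2 b2. Both results have even
weight, and comparing them shows that C has the parity of the sum of the l - 2
triangles ([cycle_weight_triangles]).

For l = 3 this says that disjoint triangles at a vertex v have the same parity, so
all triangles at v have a common parity c(v). Hence C has parity c(x2) + c(x4) + ...
+ c(xl), for any starting point. Two adjacent vertices lie on a common triangle or,
because every degree is at least 2k + 9, on a common 5-cycle; in both cases c agrees
on them ([parity_edge]). As any two vertices are at distance at most 3, c is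
constant and cycles of length l <= 7 have parity l c. These cycles generate the
cycle space, which takes the form of a potential g with f(uv) = g(u) + g(v) + c
([parity_potential]). Now every cycle of length l has parity l c, and a Hamilton
cycle, whose length is odd, forces c = 0. *)

(** * Weights of paths and cycles *)

Section Weights.
Variable T : eqType.
Implicit Types (h : T -> T -> nat) (s p q : seq T) (x y a b : T).

Fixpoint walk_weight h x p : nat :=
  if p is y :: q then h x y + walk_weight h y q else 0.

Definition path_weight h s : nat :=
  if s is x :: p then walk_weight h x p else 0.

Definition cycle_weight h s : nat :=
  if s is x :: p then walk_weight h x (rcons p x) else 0.

(** The weight counting the occurrences of the edge ab: a path or cycle passes
through ab exactly when this weight of it is positive. Being a weight, it obeys the
same exchange rules as f, so that prescribed edges can be tracked by these rules. *)
Definition joins a b x y : nat := ((x == a) && (y == b)) || ((x == b) && (y == a)).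

Lemma joins_sym a b x y : joins a b x y = joins a b y x.
Proof. by rewrite /joins orbC ![_ && (y == _)]andbC. Qed.

Lemma joinsP a b x y : 0 < joins a b x y -> (x, y) = (a, b) \/ (x, y) = (b, a).
Proof.
rewrite /joins lt0b => /orP[]/andP[/eqP-> /eqP->]; first by left.
by right.
Qed.

Lemma joins_notin a b x y : y \notin [:: a; b] -> joins a b x y = 0.
Proof. by rewrite /joins !inE => /norP[/negPf-> /negPf->]; rewrite !andbF. Qed.

Lemma walk_weight_cat h x p q :
  walk_weight h x (p ++ q) = walk_weight h x p + walk_weight h (last x p) q.
Proof. by elim: p x => //= y p IH x; rewrite IH addnA. Qed.

Lemma walk_weight_rcons h x p y :
  walk_weight h x (rcons p y) = walk_weight h x p + h (last x p) y.
Proof. by rewrite -cats1 walk_weight_cat /= addn0. Qed.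

Lemma walk_weight0 (e : rel T) x p :
  (walk_weight (fun y z => ~~ e y z : nat) x p == 0) = path e x p.
Proof. by elim: p x => //= y p IH x; rewrite addn_eq0 IH eqb0 negbK. Qed.

(** The number of non-edges is again a weight; being a cycle of the graph means
that it vanishes. *)
Lemma cycle_weight0 (e : rel T) s :
  (cycle_weight (fun y z => ~~ e y z : nat) s == 0) = cycle e s.
Proof. by case: s => //= x p; rewrite walk_weight0. Qed.

Lemma path_weight_cat h x0 p q : p != [::] -> q != [::] ->
  path_weight h (p ++ q) =
    path_weight h p + h (last x0 p) (head x0 q) + path_weight h q.
Proof.
case: p => // x p _; case: q => // y q _.
by rewrite /= walk_weight_cat /= addnA.
Qed.

Lemma cycle_weightE h x0 s : s != [::] ->
  cycle_weight h s = path_weight h s + h (last x0 s) (head x0 s).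
Proof. by case: s => // x p _; rewrite /= walk_weight_rcons. Qed.

Lemma cycle_weight_catC h p q : cycle_weight h (p ++ q) = cycle_weight h (q ++ p).
Proof.
case: p => [|x p]; first by rewrite cats0.
case: q => [|y q]; first by rewrite cats0.
rewrite /= !rcons_cat !walk_weight_cat /= !walk_weight_rcons; lia.
Qed.

Lemma last_rev x0 s : last x0 (rev s) = head x0 s.
Proof. by case: s => // x s; rewrite rev_cons last_rcons. Qed.

Lemma head_rev x0 s : head x0 (rev s) = last x0 s.
Proof. by rewrite -last_rev revK. Qed.

Lemma rev_neq_nil s : (rev s != [::]) = (s != [::]).
Proof. by rewrite -!size_eq0 size_rev. Qed.

Lemma cycle_weight_cat3 h x0 p q r :
    p != [::] -> q != [::] -> r != [::] ->
  cycle_weight h (p ++ q ++ r) =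
    path_weight h p + path_weight h q + path_weight h r +
    (h (last x0 p) (head x0 q) + h (last x0 q) (head x0 r) +
     h (last x0 r) (head x0 p)).
Proof.
case: p => // x p _; case: q => // y q _; case: r => // z r _ /=.
rewrite rcons_cat /= rcons_cat !walk_weight_cat /= walk_weight_cat /=.
rewrite walk_weight_rcons; lia.
Qed.

Section Symmetric.
Variable h : T -> T -> nat.
Hypothesis hC : forall x y, h x y = h y x.

Lemma path_weight_rev s : path_weight h (rev s) = path_weight h s.
Proof.
elim: s => // x s IH; case: s IH => // y s IH.
rewrite rev_cons -cats1 (path_weight_cat _ x) ?rev_neq_nil //.
by rewrite IH last_rev /= hC addn0 addnC.
Qed.

Lemma cycle_weight_rev s : cycle_weight h (rev s) = cycle_weight h s.
Proof.
case: s => // x s; rewrite !(cycle_weightE _ x) ?rev_neq_nil //.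
by rewrite path_weight_rev last_rev head_rev hC.
Qed.

(** The first of two ways to reconnect three segments of a cycle. Stating it for an
arbitrary symmetric weight gives at once the effect on the number of non-edges and
on the passage through every prescribed edge. *)
Lemma cycle_weight_reverse_ends x0 p q r :
    p != [::] -> q != [::] -> r != [::] ->
  cycle_weight h (rev p ++ q ++ rev r) +
    (h (last x0 p) (head x0 q) + h (last x0 q) (head x0 r) +
     h (last x0 r) (head x0 p)) =
  cycle_weight h (p ++ q ++ r) +
    (h (head x0 p) (head x0 q) + h (last x0 r) (last x0 q) +
     h (last x0 p) (head x0 r)).
Proof.
move=> p0 q0 r0; rewrite !(cycle_weight_cat3 _ x0) ?rev_neq_nil //.
rewrite !path_weight_rev !last_rev !head_rev.
rewrite (hC (last x0 r) (last x0 q)) (hC (last x0 p) (head x0 r)); lia.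
Qed.

(** The other reconnection, for the case in which the neighbours of the two ends
of the closing arc occur in the opposite order. *)
Lemma cycle_weight_swap_ends x0 p q r :
    p != [::] -> q != [::] -> r != [::] ->
  cycle_weight h (r ++ q ++ rev p) +
    (h (last x0 p) (head x0 q) + h (last x0 q) (head x0 r) +
     h (last x0 r) (head x0 p)) =
  cycle_weight h (p ++ q ++ r) +
    (h (head x0 p) (head x0 r) + h (last x0 r) (head x0 q) +
     h (last x0 p) (last x0 q)).
Proof.
move=> p0 q0 r0; rewrite !(cycle_weight_cat3 _ x0) ?rev_neq_nil //.
rewrite !path_weight_rev !last_rev !head_rev.
rewrite (hC (last x0 p) (last x0 q)); lia.
Qed.

Lemma path_weight_insert p q a b x :
  path_weight h (p ++ [:: a, x, b & q]) + h a b =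
  path_weight h (p ++ [:: a, b & q]) + h a x + h x b.
Proof.
case: p => [|y p] /=; last rewrite !walk_weight_cat /=; lia.
Qed.

End Symmetric.

Lemma path_weight_joins_gt0 p q a b : 0 < path_weight (joins a b) (p ++ [:: a, b & q]).
Proof.
have e : 0 < joins a b a b by rewrite /joins !eqxx.
by case: p => [|y p] /=; last rewrite walk_weight_cat /=; lia.
Qed.

Lemma path_weight_gt0P h s : 0 < path_weight h s ->
  exists p q x y, s = p ++ [:: x, y & q] /\ 0 < h x y.
Proof.
case: s => // x s /=; elim: s x => // y s IH x /=.
have [->|hxy _] := posnP (h x y); last by exists [::], s, x, y.
by rewrite add0n => /IH[p [q [z [t [-> hzt]]]]]; exists (x :: p), q, z, t.
Qed.

Lemma path_weight_joinsP a b s : 0 < path_weight (joins a b) s ->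
  exists p q, s = p ++ [:: a, b & q] \/ s = p ++ [:: b, a & q].
Proof.
case/path_weight_gt0P=> p [q [x [y [-> /joinsP[][-> ->]]]]]; exists p, q.
  by left.
by right.
Qed.

Lemma cycle_weight_rot h k s : cycle_weight h (rot k s) = cycle_weight h s.
Proof. by rewrite /rot cycle_weight_catC cat_take_drop. Qed.

(** Rotation lets the arc of positive weight be the closing one. *)
Lemma cycle_weight_gt0P h x0 s : 0 < cycle_weight h s ->
  exists k, 0 < h (last x0 (rot k s)) (head x0 (rot k s)).
Proof.
case: s => // z s; rewrite (cycle_weightE _ x0) // addn_gt0.
case/orP=> [/path_weight_gt0P[p [q [x [y [-> hxy]]]]]|hz]; last first.
  by exists 0; rewrite rot0.
exists (size (rcons p x)); rewrite -cat_rcons rot_size_cat /=.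
by rewrite last_cat last_rcons.
Qed.

Lemma path_weight_le_cycle h s : path_weight h s <= cycle_weight h s.
Proof. by case: s => //= x p; rewrite walk_weight_rcons leq_addr. Qed.

Lemma nth_sub_uniq x0 (s : seq T) (f : nat -> nat) (I : seq nat) :
  uniq s -> uniq I -> {in I &, injective f} -> {in I, forall i, f i < size s} ->
  uniq [seq nth x0 s (f i) | i <- I].
Proof.
move=> us uI fi fs; rewrite map_inj_in_uniq // => i j iI jI /eqP.
by rewrite nth_uniq ?fs // => /eqP /fi; apply.
Qed.

Lemma cut_in_three x0 (s : seq T) k l : 0 < k -> k < l -> l < size s ->
  exists p q r, s = p ++ q ++ r /\
  [/\ [/\ p != [::], q != [::] & r != [::]],
      head x0 p = head x0 s /\ last x0 p = nth x0 s k.-1,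
      head x0 q = nth x0 s k /\ last x0 q = nth x0 s l.-1 &
      head x0 r = nth x0 s l /\ last x0 r = last x0 s].
Proof.
move=> k0 kl ls; exists (take k s), (drop k (take l s)), (drop l s).
have ne (t : seq T) : 0 < size t -> t != [::] by case: t.
have nq : drop k (take l s) != [::] by apply: ne; rewrite size_drop size_take_min; lia.
have lt m : 0 < m -> m <= size s -> last x0 (take m s) = nth x0 s m.-1.
  move=> m0 ms; rewrite -nth_last size_take_min nth_take; last by lia.
  by congr nth; lia.
split; first by rewrite catA -(take_takel s (ltnW kl)) !cat_take_drop.
split; first by split=> //; apply: ne; rewrite ?size_drop ?size_take_min; lia.
- split; last by rewrite lt //; lia.
  by case: (s) (k) k0 => [|x t] [|m].
- rewrite -nth0 nth_drop nth_take addn0 //; split=> //.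
  rewrite -lt; try lia.
  rewrite -[in RHS](cat_take_drop k (take l s)) last_cat.
  by case: (drop _ _) nq.
- rewrite -nth0 nth_drop addn0; split=> //.
  by rewrite -[in RHS](cat_take_drop l s) last_cat (drop_nth x0).
Qed.

End Weights.

(** * Hamilton cycles through prescribed edges *)

Section HamiltonCycle.
Variables (T : eqType) (e : rel T) (a b : nat).
Hypotheses (eC : symmetric e) (eI : irreflexive e) (a_gt0 : 0 < a) (b_gt0 : 0 < b).
Hypothesis no_hole : forall A B : seq T, uniq A -> uniq B ->
  (forall x, x \in A -> x \notin B) -> a <= size A -> b <= size B ->
  exists x y, [/\ x \in A, y \in B & e x y].

Definition nonarc x y : nat := ~~ e x y.

Lemma nonarcC x y : nonarc x y = nonarc y x.
Proof. by rewrite /nonarc eC. Qed.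

(* Z contains the ends of the prescribed edges; cutting a cycle next to a vertex
outside Z never destroys such an edge. *)
Variable Z : seq T.

(** Call a neighbour admissible if it lies outside Z, and let p be the first
position by which the first vertex has seen a of its admissible neighbours. If b of
the admissible neighbours of the last vertex lie at p or later, the predecessors of
the former and the successors of the latter form disjoint sets of sizes a and b.
Otherwise at least a admissible neighbours of the last vertex precede p while at
least b of those of the first are at p or later, and the predecessors of both do. In
each case the arc between the two sets is the one that a reconnection needs. *)
Lemma crossing_arcs x0 (s : seq T) :
    uniq s ->
    a + b - 1 <= count (fun y => e (head x0 s) y && (y \notin Z)) s ->
    a + b - 1 <= count (fun y => e (last x0 s) y && (y \notin Z)) s ->
    ~~ e (last x0 s) (head x0 s) ->
  exists i j, let v := nth x0 s in
    [/\ e (head x0 s) (v i), v i \notin Z, e (last x0 s) (v j) & v j \notin Z] /\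
    ([/\ 0 < i, i <= j, j.+1 < size s & e (v i.-1) (v j.+1)] \/
     [/\ 0 < j, j < i, i < size s & e (v j.-1) (v i.-1)]).
Proof.
move=> us d0 d1 nle.
set n := size s; set v := nth x0 s.
have n_gt0 : 0 < n.
  by rewrite /n; case: (s) d0 => //=; rewrite leqn0; lia.
pose P i := e (head x0 s) (v i) && (v i \notin Z).
pose Q i := e (last x0 s) (v i) && (v i \notin Z).
have cnt (R : pred T) : count R s = count (fun i => R (v i)) (iota 0 n).
  by rewrite -[in LHS](mkseq_nth x0 s) /mkseq count_map.
rewrite !cnt -/(P) -/(Q) in d0 d1.
have split_iota (R : pred nat) m : m <= n ->
    count R (iota 0 n) = count R (iota 0 m) + count R (iota m (n - m)).
  by move=> mn; rewrite -count_cat -iotaD subnKC.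
(* Positions 0 and n - 1 have to be excluded for predecessors and successors to
exist. *)
have P0 : ~~ P 0 by rewrite /P /v nth0 eI.
have Q0 : ~~ Q 0 by rewrite /Q /v nth0 (negPf nle).
have Qn : ~~ Q n.-1 by rewrite /Q /v nth_last eI.
have ex_p : exists p, (p < n) && (a <= count P (iota 0 p.+1)).
  by exists n.-1; rewrite prednK // leqnn /=; apply: leq_trans d0; lia.
have [p /andP[pn ap] p_min] := ex_minnP ex_p.
have lt_p : count P (iota 0 p) < a.
  case: p pn ap p_min => [//|p] pn ap p_min.
  rewrite ltnNge; apply/negP => ap'.
  by have := p_min p; rewrite ap' (ltnW pn) ltnn => /(_ isT).
have vinj i j : i < n -> j < n -> (v i == v j) = (i == j) by move=> *; apply: nth_uniq.
have shifted_arc A B (f g : nat -> nat) :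
    uniq A -> uniq B -> {in A &, injective f} -> {in B &, injective g} ->
    (forall i j, i \in A -> j \in B -> f i < g j < n) ->
    (0 < size B) ->
    a <= size A -> b <= size B ->
    exists i j, [/\ i \in A, j \in B & e (v (f i)) (v (g j))].
  move=> uA uB fi gi fg B0 aA bB.
  have A0 : 0 < size A by lia.
  have fn : {in A, forall i, f i < size s}.
    by move=> i /fg /(_ (mem_nth 0 B0)); rewrite -/n; lia.
  have gn : {in B, forall i, g i < size s}.
    by move=> i /(fg _ _ (mem_nth 0 A0)); rewrite -/n; lia.
  have uA' : uniq [seq v (f i) | i <- A] by apply: nth_sub_uniq.
  have uB' : uniq [seq v (g j) | j <- B] by apply: nth_sub_uniq.
  have dis x : x \in [seq v (f i) | i <- A] -> x \notin [seq v (g j) | j <- B].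
    case/mapP=> i iA ->; apply/mapP => -[j jB /eqP].
    by have /andP[fij gj] := fg _ _ iA jB; rewrite vinj ?(ltn_trans fij) // (ltn_eqF fij).
  have := no_hole uA' uB' dis; rewrite !size_map => /(_ aA bB).
  by case=> _ [_ [/mapP[i iA ->] /mapP[j jB ->] ij]]; exists i, j.
have memf R m k i : (i \in filter R (iota m k)) = R i && (m <= i < m + k).
  by rewrite mem_filter mem_iota.
have pos R m k : ~~ R 0 -> {in filter R (iota m k), forall i, 0 < i}.
  move=> R0 i; rewrite memf lt0n => /andP[Ri _].
  by apply: contraTneq Ri => ->.
have inj_pred R m k : ~~ R 0 -> {in filter R (iota m k) &, injective predn}.
  by move=> R0 i j /(pos _ _ _ R0) i0 /(pos _ _ _ R0) j0; lia.
have [bQ|Qb] := leqP b (count Q (iota p (n - p))).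
  have [||||||||i [j [iA jB ij]]] := shifted_arc (filter P (iota 0 p.+1))
    (filter Q (iota p (n - p))) predn succn; rewrite ?size_filter ?filter_uniq ?iota_uniq //.
  - exact: inj_pred.
  - by move=> i j _ _ [].
  - move=> i j; rewrite !memf => /andP[Pi lei] /andP[Qj lej].
    have : i != 0 by apply: contraTneq Pi => ->.
    have : j != n.-1 by apply: contraTneq Qj => ->.
    lia.
  - by apply: leq_trans bQ.
  move: iA jB; rewrite !memf => /andP[Pi lei] /andP[Qj lej].
  exists i, j; move: (Pi) (Qj) => /andP[? ?] /andP[? ?]; split=> //; left.
  have i0 : i != 0 by apply: contraTneq Pi => ->.
  have jn : j != n.-1 by apply: contraTneq Qj => ->.
  split=> //; first by rewrite lt0n.
    by case/andP: lei lej => _; clear; lia.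
  by case/andP: lej jn; rewrite -/n; clear; lia.
have cP : b <= count P (iota p (n - p)).
  have := split_iota P p (ltnW pn); lia.
have cQ : a <= count Q (iota 0 p).
  have := split_iota Q p (ltnW pn); lia.
have [||||||||j [i [jA iB ij]]] := shifted_arc (filter Q (iota 0 p))
    (filter P (iota p (n - p))) predn predn; rewrite ?size_filter ?filter_uniq ?iota_uniq //.
- exact: inj_pred.
- exact: inj_pred.
- move=> i j; rewrite !memf => /andP[Qi lei] /andP[Pj lej].
  have : i != 0 by apply: contraTneq Qi => ->.
  lia.
- by apply: leq_trans cP.
move: jA iB; rewrite !memf => /andP[Qj lej] /andP[Pi lei].
exists i, j; move: (Pi) (Qj) => /andP[? ?] /andP[? ?]; split=> //; right.
have j0 : j != 0 by apply: contraTneq Qj => ->.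
split=> //; first by rewrite lt0n.
  by move: lej lei; clear; lia.
by move: lei pn; rewrite -/n; clear; lia.
Qed.

(** The closing arc, a non-edge, and two arcs at vertices outside Z are replaced by
three edges: no prescribed edge is lost and the number of non-edges drops. *)
Lemma fewer_nonarcs (F : seq (T * T)) x0 (s : seq T) :
    uniq s -> {in s, forall x, a + b - 1 <= count (fun y => e x y && (y \notin Z)) s} ->
    {in F, forall q, [/\ e q.1 q.2, q.1 \in Z & q.2 \in Z]} ->
    {in F, forall q, 0 < cycle_weight (joins q.1 q.2) s} ->
    s != [::] -> ~~ e (last x0 s) (head x0 s) ->
  exists s', [/\ perm_eq s' s, {in F, forall q, 0 < cycle_weight (joins q.1 q.2) s'} &
    cycle_weight nonarc s' < cycle_weight nonarc s].
Proof.
move=> us deg eF sF s_ne bad.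
have hs : head x0 s \in s by case: (s) s_ne => //= *; rewrite mem_head.
have ls : last x0 s \in s by case: (s) s_ne => //= *; rewrite mem_last.
have [i [j [[hi iZ hj jZ] cross]]] := crossing_arcs us (deg _ hs) (deg _ ls) bad.
have badF q : q \in F -> joins q.1 q.2 (last x0 s) (head x0 s) = 0.
  move=> /eF[eq _ _]; apply/eqP; rewrite -leqn0 leqNgt; apply/negP => /joinsP.
  by case=> -[lq hq]; move: bad; rewrite lq hq ?eq // eC eq.
have ZF q x y : q \in F -> y \notin Z -> joins q.1 q.2 x y = 0.
  move=> /eF[_ q1 q2] yZ; apply: joins_notin; rewrite !inE; apply/norP.
  by split; apply: contraNneq yZ => ->.
have ZF' q x y : q \in F -> x \notin Z -> joins q.1 q.2 x y = 0.
  by rewrite joins_sym; apply: ZF.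
have nh x y : e x y -> nonarc x y = 0 by rewrite /nonarc => ->.
have nbad : nonarc (last x0 s) (head x0 s) = 1 by rewrite /nonarc (negPf bad).
case: cross => [[i0 ij js eij]|[j0 ji is_ eij]].
  have [p [q [r [sE [[p0 q0 r0] [hp lp] [hq lq] [hr lr]]]]]] := cut_in_three x0 i0 (ij : i < j.+1) js.
  have W g : (forall x y, g x y = g y x) -> _ :=
    fun gC => @cycle_weight_reverse_ends _ g gC x0 p q r p0 q0 r0.
  rewrite -sE hp lp hq lq hr lr /= in W.
  exists (rev p ++ q ++ rev r); split.
  - by apply/permP => P; rewrite [in RHS]sE !count_cat !count_rev.
  - move=> f fF; move: (W _ (joins_sym f.1 f.2)) (sF _ fF); rewrite badF //.
    rewrite !(ZF _ _ _ fF iZ) !(ZF' _ _ _ fF jZ); clear; lia.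
  - have := W _ nonarcC; rewrite nbad !(nh _ _ hi) !(nh _ _ hj) (nh _ _ eij); clear; lia.
have [p [q [r [sE [[p0 q0 r0] [hp lp] [hq lq] [hr lr]]]]]] := cut_in_three x0 j0 ji is_.
have W g : (forall x y, g x y = g y x) -> _ :=
  fun gC => @cycle_weight_swap_ends _ g gC x0 p q r p0 q0 r0.
rewrite -sE hp lp hq lq hr lr /= in W.
exists (r ++ q ++ rev p); split.
- by apply/permP => P; rewrite [in RHS]sE !count_cat count_rev; clear; lia.
- move=> f fF; move: (W _ (joins_sym f.1 f.2)) (sF _ fF); rewrite badF //.
  rewrite !(ZF _ _ _ fF iZ) !(ZF _ _ _ fF jZ); clear; lia.
- have := W _ nonarcC; rewrite nbad !(nh _ _ hi) !(nh _ _ hj) (nh _ _ eij); clear; lia.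
Qed.

(** Start from any cyclic order of the vertices, not a cycle of the graph in general,
that contains the prescribed edges, and remove its non-edges one at a time. *)
Theorem hamilton_cycle_through (F : seq (T * T)) (s0 : seq T) :
    uniq s0 -> {in s0, forall x, a + b - 1 <= count (fun y => e x y && (y \notin Z)) s0} ->
    {in F, forall q, [/\ e q.1 q.2, q.1 \in Z & q.2 \in Z]} ->
    {in F, forall q, 0 < cycle_weight (joins q.1 q.2) s0} ->
  exists s, [/\ perm_eq s s0, cycle e s &
    {in F, forall q, 0 < cycle_weight (joins q.1 q.2) s}].
Proof.
have [m] := ubnP (cycle_weight nonarc s0); elim: m s0 => // m IH s.
rewrite ltnS => sm us deg eF sF; case: (boolP (cycle e s)) => [es|]; first by exists s.
rewrite -cycle_weight0 -lt0n; case: s sm us deg sF => // x0 s.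
move: (x0 :: s) => {}s sm us deg sF /[dup] s_bad /(cycle_weight_gt0P x0)[k]; rewrite lt0b => bad.
have ps : perm_eq (rot k s) s by rewrite perm_rot.
have [||||||s' [ps' s'F s'm]] := @fewer_nonarcs F x0 (rot k s) => //.
- by rewrite rot_uniq.
- by move=> x; rewrite mem_rot => /deg; rewrite (permP ps).
- by move=> q /sF; rewrite cycle_weight_rot.
- by rewrite -size_eq0 size_rot; case: (s) s_bad.
rewrite cycle_weight_rot in s'm; have pss := perm_trans ps' ps.
have [|||||s2 [ps2 es2 s2F]] := IH s' => //.
- by apply: leq_trans s'm sm.
- by rewrite (perm_uniq pss).
- by move=> x; rewrite (perm_mem pss) => /deg; rewrite (permP pss).
by exists s2; split=> //; apply: perm_trans pss.
Qed.

End HamiltonCycle.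

(** * Inserting vertices into a path *)

Section Insertion.
Variable T : eqType.
Implicit Types (p : seq T) (F : seq (T * T)) (L : seq (T * (T * T))).

Definition ends F : seq T := flatten [seq [:: q.1; q.2] | q <- F].

Lemma size_ends F : size (ends F) = 2 * size F.
Proof. by elim: F => //= q F /= ->; rewrite mulnS. Qed.

Lemma mem_ends F q : q \in F -> (q.1 \in ends F) /\ (q.2 \in ends F).
Proof.
move=> qF; split; apply/flattenP; exists [:: q.1; q.2];
  by rewrite ?inE ?eqxx ?orbT //; apply/mapP; exists q.
Qed.

(** The equation for all symmetric weights at once says that p' is a path of the graph
(weight: non-edges), keeps the other prescribed edges (weight: [joins]), and has the
parity required (weight: f). *)
Lemma insert_vertex x a b p : 0 < path_weight (joins a b) p ->
  exists p', [/\ perm_eq p' (x :: p), p' != [::],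
    forall x0, head x0 p' = head x0 p /\ last x0 p' = last x0 p &
    forall h : T -> T -> nat, (forall y z, h y z = h z y) ->
      path_weight h p' + h a b = path_weight h p + (h x a + h x b)].
Proof.
move=> /path_weight_joinsP[q [r pE]].
wlog -> : a b pE / p = q ++ [:: a, b & r] => [IH|{p pE}].
  case: pE => E.
    by apply: IH => //; left.
  have [||p' [pp n hl w]] := IH b a => //; first by left.
  exists p'; split=> // h hC; have := w h hC.
  by rewrite (hC b a) (addnC (h x b)).
exists (q ++ [:: a, x, b & r]); split.
- by apply/permP => P; rewrite /= !count_cat /=; lia.
- by case: q.
- by move=> x0; rewrite !last_cat; case: q.
move=> h hC; rewrite path_weight_insert; rewrite (hC x a); lia.
Qed.

Lemma insert_vertices L p : p != [::] -> uniq (ends (unzip2 L)) ->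
    {in L, forall q, 0 < path_weight (joins q.2.1 q.2.2) p} ->
  exists p', [/\ perm_eq p' (unzip1 L ++ p), p' != [::],
    forall x0, head x0 p' = head x0 p /\ last x0 p' = last x0 p &
    forall h : T -> T -> nat, (forall y z, h y z = h z y) ->
      path_weight h p' + \sum_(q <- L) h q.2.1 q.2.2 =
      path_weight h p + \sum_(q <- L) (h q.1 q.2.1 + h q.1 q.2.2)].
Proof.
elim: L p => [|[x [a b]] L IH] p p0 /=.
  by exists p; split=> // h _; rewrite !big_nil.
case/and3P=> aL bL uL Lp.
have [p1 [pp1 p10 hl1 w1]] := insert_vertex x (Lp _ (mem_head _ _)).
have {IH}[|p2 [pp2 p20 hl2 w2]] := IH p1 p10 uL.
  move=> q qL; have := w1 _ (joins_sym q.2.1 q.2.2).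
  have /mem_ends[q1 q2] : q.2 \in unzip2 L by apply/mapP; exists q.
  rewrite joins_notin; last first.
    by rewrite !inE; apply/norP; split; apply: contraNneq bL => /= ->.
  have : q \in (x, (a, b)) :: L by rewrite inE qL orbT.
  by move=> /Lp; rewrite addn0 => q0 ->; rewrite ltn_addr.
exists p2; split=> //.
- apply: (perm_trans pp2); rewrite perm_sym -cat_cons -cat1s -catA perm_catCA.
  by rewrite perm_cat2l perm_sym.
- by move=> x0; case: (hl2 x0) => -> ->.
move=> h hC; rewrite !big_cons /=; move: (w1 h hC) (w2 h hC) => /=.
lia.
Qed.

Lemma path_weight_ends F p r q : q \in F ->
  0 < path_weight (joins q.1 q.2) (p ++ ends F ++ r).
Proof.
case/splitPr=> F1 F2; rewrite /ends map_cat flatten_cat /= -catA catA.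
exact: path_weight_joins_gt0.
Qed.

Lemma cycle_weight_cat h x0 p r : p != [::] ->
  cycle_weight h (p ++ r) =
    path_weight h p + walk_weight h (last x0 p) (rcons r (head x0 p)).
Proof. by case: p => // x p _ /=; rewrite rcons_cat walk_weight_cat. Qed.

Lemma cycle_weight_joins_cons a b x p : x \notin [:: a; b] ->
  cycle_weight (joins a b) (x :: p) = path_weight (joins a b) p.
Proof.
move=> xab; have j0 y : joins a b x y = 0 by rewrite joins_sym joins_notin.
by case: p => [|y p] /=; rewrite ?j0 // walk_weight_rcons joins_notin // addn0.
Qed.

Lemma cycle_weight_joins_first x0 a x p : x \notin p -> p != [::] ->
  0 < cycle_weight (joins a x) (x :: p) -> a = head x0 p \/ a = last x0 p.
Proof.
case: p => // y p xp _; rewrite /= walk_weight_rcons !addn_gt0.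
case/or3P=> [/joinsP[][]|/(@path_weight_joinsP _ a x (y :: p))[q [r E]]|/joinsP[][]].
- by move=> _ E; rewrite -E mem_head in xp.
- by left.
- by move: xp; case: E => ->; rewrite mem_cat !inE eqxx ?orbT.
- by right.
- by move=> E; rewrite -E mem_last in xp.
Qed.

End Insertion.

(** * Parities of short cycles *)

Section ParityTransfer.
Variables (T : finType) (e : rel T) (a b : nat) (f : T -> T -> nat).
Hypotheses (eC : symmetric e) (eI : irreflexive e) (a_gt0 : 0 < a) (b_gt0 : 0 < b).
Hypothesis no_hole : forall A B : seq T, uniq A -> uniq B ->
  (forall x, x \in A -> x \notin B) -> a <= size A -> b <= size B ->
  exists x y, [/\ x \in A, y \in B & e x y].
Hypothesis deg18 : forall x, a + b - 1 + 18 <= count (e x) (enum T).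
Hypothesis fC : forall x y, f x y = f y x.
Hypothesis ham_even : forall s, uniq s -> size s = #|T| -> cycle e s ->
  ~~ odd (cycle_weight f s).

Lemma count_avoid (Y : seq T) (P : pred T) :
  count P (enum T) <= count (fun y : T => P y && (y \notin Y)) (enum T) + size Y.
Proof.
set A := fun y : T => P y && (y \notin Y).
have le : count P (enum T) <= count (predU A (mem Y)) (enum T).
  by apply: sub_count => y /=; rewrite /A => ->; case: (y \in Y).
apply: leq_trans le (leq_trans (leq_addr (count (predI A (mem Y)) (enum T)) _) _).
rewrite count_predUI leq_add2l -size_filter; apply: uniq_leq_size => [|y].
  by rewrite filter_uniq ?enum_uniq.
by rewrite mem_filter => /andP[].
Qed.

(** An entry (x, (y, z)) of L is the triangle xyz, used to insert x in the edge yz. The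
two Hamilton cycles of the comparison are [x2 :: p1] and [p2 ++ r] below. *)
Lemma cycle_weight_triangles x1 x2 x3 (r : seq T) (L : seq (T * (T * T))) :
    uniq ([:: x1, x2, x3 & r] ++ ends (unzip2 L)) ->
    cycle e [:: x1, x2, x3 & r] -> unzip1 L = x2 :: r ->
    {in L, forall q, cycle e [:: q.1; q.2.1; q.2.2]} -> size r <= 4 ->
  odd (cycle_weight f [:: x1, x2, x3 & r]) =
  odd (\sum_(q <- L) cycle_weight f [:: q.1; q.2.1; q.2.2]).
Proof.
move=> uCL eCr L1 eL r4.
have [Z ZE] : exists Z, Z = [:: x1; x2; x3] ++ ends (unzip2 L) by eexists.
pose F := [:: (x1, x2), (x3, x2) & unzip2 L].
pose s0 := Z ++ [seq y <- enum T | y \notin Z ++ r].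
have uZr : uniq (Z ++ r).
  by move: uCL; apply: etrans; apply: perm_uniq; rewrite ZE -catA /= !perm_cons perm_catC.
have /and3P[uZ Zr ur] : [&& uniq Z, ~~ has (mem Z) r & uniq r] by rewrite -cat_uniq.
have us0 : uniq s0.
  rewrite cat_uniq uZ filter_uniq ?enum_uniq // andbT; apply/hasPn => y.
  by rewrite mem_filter mem_cat => /andP[/norP[]].
have ms0 y : (y \in s0) = (y \notin r).
  rewrite (mem_cat y Z) mem_filter mem_enum andbT (mem_cat y Z) negb_or.
  have [yZ|//] := boolP (y \in Z); apply/esym.
  by apply/negP => yr; move/negP: Zr; apply; apply/hasP; exists y.
have sL : size L = (size r).+1 by rewrite -(size_map fst) [map _ _]L1.
have [||||s [ps es sF]] := @hamilton_cycle_through T e a b eC eI a_gt0 b_gt0 no_hole Z F s0 => //.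
(* At most 4 deleted vertices, x1, x2, x3, and the ends of at most 5 edges: 17 in
  all, whence the surplus of 18 suffices. *)
- move=> x _; have -> : count (fun y => e x y && (y \notin Z)) s0 =
      count (fun y => e x y && (y \notin Z ++ r)) (enum T).
    have p0 : perm_eq s0 [seq y <- enum T | y \notin r].
      apply: uniq_perm => //; first by rewrite filter_uniq ?enum_uniq.
      by move=> y; rewrite ms0 mem_filter mem_enum andbT.
    rewrite (permP p0) count_filter; apply: eq_count => y /=.
    by rewrite mem_cat negb_or andbA.
  have := leq_trans (deg18 x) (count_avoid (Z ++ r) (e x)).
  rewrite ZE !size_cat size_ends size_map sL; move: r4; clear; rewrite /=; lia.
- move: eCr; rewrite /= => /and3P[e12 e23 _].
  move=> q; rewrite !inE => /or3P[/eqP->|/eqP->|/[dup] qL /mem_ends[q1 q2]].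
  + by rewrite ZE !inE !eqxx ?orbT.
  + by rewrite ZE eC !inE !eqxx ?orbT.
  + split; rewrite ?ZE ?mem_cat ?q1 ?q2 ?orbT //.
    by case/mapP: qL => l /eL /= /and3P[_ ? _] ->.
- move=> q; rewrite !inE => /or3P[/eqP->|/eqP->|qL].
  + by rewrite /s0 ZE /= /joins !eqxx.
  + by rewrite /s0 ZE /= addnCA addn_gt0 /joins !eqxx orbT.
  + apply: leq_trans (path_weight_le_cycle _ _).
    by rewrite /s0 ZE -catA; apply: path_weight_ends.
have x2s : x2 \in s by rewrite (perm_mem ps) /s0 ZE !inE eqxx orbT.
have [i p0 sE] := rot_to x2s.
have {ps} ps : perm_eq (x2 :: p0) s0 by rewrite -sE perm_rot.
have x2L q : q \in unzip2 L -> x2 \notin [:: q.1; q.2].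
  move=> /mem_ends[q1 q2]; rewrite !inE; apply/norP.
  have : x2 \notin ends (unzip2 L) by move: uZ; rewrite ZE /= => /and3P[_]; rewrite inE negb_or => /andP[].
  by move=> n; split; apply: contraNneq n => ->.
have x13 : x1 != x3 by move: uZ; rewrite ZE /= => /andP[]; rewrite !inE !negb_or => /and3P[_].
have x12 : x1 != x2 by move: uZ; rewrite ZE /= => /andP[]; rewrite !inE !negb_or => /and3P[].
have x2p0 : x2 \notin p0 by move: us0; rewrite -(perm_uniq ps) => /andP[].
have p0_ne : p0 != [::].
  apply/eqP => E; have : x1 \in x2 :: p0 by rewrite (perm_mem ps) /s0 ZE mem_head.
  by rewrite E inE (negPf x12).
have cw0 : cycle_weight (nonarc e) (x2 :: p0) = 0.
  by rewrite -sE cycle_weight_rot; apply/eqP; rewrite cycle_weight0.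
(* Cut the Hamilton cycle at x2; its two neighbours there are x1 and x3, and the
  remaining path is oriented from x1 to x3. *)
have [p [p_ne pp pw hp lp]] : exists p, [/\ p != [::], perm_eq p p0,
    forall h : T -> T -> nat, (forall y z, h y z = h z y) ->
      cycle_weight h (x2 :: p) = cycle_weight h (x2 :: p0),
    head x1 p = x1 & last x1 p = x3].
  have h1 : x1 = head x1 p0 \/ x1 = last x1 p0.
    apply: (cycle_weight_joins_first x1 x2p0 p0_ne); rewrite -sE cycle_weight_rot.
    by apply: (sF (x1, x2)); rewrite mem_head.
  have h3 : x3 = head x1 p0 \/ x3 = last x1 p0.
    apply: (cycle_weight_joins_first x1 x2p0 p0_ne); rewrite -sE cycle_weight_rot.
    by apply: (sF (x3, x2)); rewrite !inE eqxx orbT.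
  case: h1 h3 => E1 [] E3; try by rewrite E1 -E3 eqxx in x13.
    by exists p0.
  exists (rev p0); split; rewrite ?rev_neq_nil ?perm_rev ?head_rev ?last_rev //.
  move=> h hC; rewrite -(cycle_weight_rev hC (x2 :: p0)) rev_cons -cats1.
  by rewrite cycle_weight_catC.
have {}ps : perm_eq (x2 :: p) s0 by apply: perm_trans ps; rewrite perm_cons.
have Np : nonarc e x1 x2 = 0 by rewrite /nonarc; move: eCr => /= /andP[->].
have Np3 : nonarc e x2 x3 = 0 by rewrite /nonarc; move: eCr => /= /and3P[_ ->].
have NC := nonarcC eC.
have cC h : cycle_weight h [:: x1, x2, x3 & r] =
    h x1 x2 + h x2 x3 + walk_weight h x3 (rcons r x1).
  by rewrite (@cycle_weight_cat _ h x1 [:: x1; x2; x3] r) //= addn0.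
have NK : walk_weight (nonarc e) x3 (rcons r x1) = 0.
  by move: eCr; rewrite -cycle_weight0 cC addn_eq0 => /andP[_ /eqP].
have closeE h q : head x1 q = x1 -> last x1 q = x3 -> q != [::] ->
    cycle_weight h (x2 :: q) = path_weight h q + (h x3 x2 + h x2 x1).
  move=> hq lq q0; rewrite -cat1s cycle_weight_catC (cycle_weight_cat h x1) //.
  by rewrite hq lq /= addn0.
have Nlp : path_weight (nonarc e) p = 0.
  by have /eqP := pw _ NC; rewrite cw0 closeE // addn_eq0 => /andP[/eqP].
have pL q : q \in L -> 0 < path_weight (joins q.2.1 q.2.2) p.
  move=> qL; have q2 : q.2 \in unzip2 L by apply/mapP; exists q.
  rewrite -(cycle_weight_joins_cons _ (x2L _ q2)) pw; last by move=> *; apply: joins_sym.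
  by rewrite -sE cycle_weight_rot; apply: sF; rewrite !inE q2 !orbT.
have eL0 q : q \in L -> [/\ nonarc e q.1 q.2.1 = 0, nonarc e q.1 q.2.2 = 0 &
    nonarc e q.2.1 q.2.2 = 0].
  by move=> /eL /= /and4P[e1 e2 e3 _]; rewrite /nonarc e1 e2 (eC q.1) e3.
have perm_all t : perm_eq t (r ++ (x2 :: p)) -> uniq t /\ size t = #|T|.
  move=> pt; have : perm_eq t (enum T).
    apply: uniq_perm => [||y]; rewrite ?enum_uniq //.
      rewrite (perm_uniq pt) uniq_catC cat_uniq (perm_uniq ps) us0 ur andbT.
      by apply/hasPn => y; rewrite !(perm_mem ps) ms0 negbK.
    by rewrite (perm_mem pt) mem_cat (perm_mem ps) ms0 mem_enum orbN.
  by move=> pe; rewrite (perm_uniq pe) enum_uniq (perm_size pe) -cardT.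
have [q [L' [LE qx2 L'r]]] : exists q L', [/\ L = q :: L', q.1 = x2 & unzip1 L' = r].
  by case: (L) L1 => // q L' [? ?]; exists q, L'.
have uL : uniq (ends (unzip2 L)) by move: uCL; rewrite cat_uniq => /and3P[].
have uL' : uniq (ends (unzip2 L')).
  by move: uL; rewrite LE (cat_uniq [:: _; _]) => /and3P[].
have L'L l : l \in L' -> l \in L by rewrite LE inE orbC => ->.
have qL : q \in L by rewrite LE mem_head.
have [|p1 [pp1 p1_ne hl1 w1]] := insert_vertices p_ne uL'; first by move=> l /L'L /pL.
have [p2 [pp2 p2_ne hl2 w2]] := insert_vertex q.1 (pL _ qL).
have even1 : ~~ odd (cycle_weight f (x2 :: p1)).
  have [|u1 s1] := perm_all (x2 :: p1).
    by rewrite perm_sym perm_catC /= perm_cons perm_catC perm_sym -L'r.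
  apply: ham_even => //; rewrite -cycle_weight0 -/(nonarc e) closeE //; last first.
  - by rewrite (hl1 x1).2.
  - by rewrite (hl1 x1).1.
  have := w1 _ NC; rewrite Nlp !big1_seq ?addn0; first by move=> ->; rewrite NC Np3 NC Np.
  - by move=> l /= /L'L/eL0[-> ->].
  - by move=> l /= /L'L/eL0[].
have even2 : ~~ odd (cycle_weight f (p2 ++ r)).
  have [|u1 s1] := perm_all (p2 ++ r); first by rewrite perm_catC perm_cat2l -qx2.
  apply: ham_even => //; rewrite -cycle_weight0 -/(nonarc e) (cycle_weight_cat _ x1) //.
  rewrite (hl2 x1).1 (hl2 x1).2 hp lp NK addn0.
  by have := w2 _ NC; have [-> -> ->] := eL0 _ qL; rewrite Nlp !addn0 => ->.
move: even1 even2 (w1 _ fC) (w2 _ fC).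
rewrite closeE ?(hl1 x1).1 ?(hl1 x1).2 // (cycle_weight_cat _ x1) // (hl2 x1).1 (hl2 x1).2.
rewrite hp lp cC LE big_cons /= qx2 (fC x3 x2) (fC x2 x1) addn0.
have -> : \sum_(l <- L') (f l.1 l.2.1 + (f l.2.1 l.2.2 + (f l.2.2 l.1 + 0))) =
    \sum_(l <- L') (f l.1 l.2.1 + f l.1 l.2.2) + \sum_(l <- L') f l.2.1 l.2.2.
  by rewrite -big_split; apply: eq_bigr => l _; rewrite (fC l.2.2) addn0 (addnC (f l.2.1 _)) addnA.
rewrite (fC q.2.2).
move: (path_weight f p) (path_weight f p1) (path_weight f p2) (walk_weight _ _ _).
move: (f x1 x2) (f x2 x3) (f x2 q.2.1) (f x2 q.2.2) (f q.2.1 q.2.2) (bigop _ _ _) (bigop _ _ _).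
clear => *; lia.
Qed.

(** A set of a + b vertices splits into parts of sizes a and b. *)
Lemma arc_inside (X : seq T) : uniq X -> a + b <= size X ->
  exists x y, [/\ x \in X, y \in X & e x y].
Proof.
move=> uX sX; have uX' : uniq (take a X ++ drop a X) by rewrite cat_take_drop.
move: uX'; rewrite cat_uniq => /and3P[u1 /hasPn dis u2].
have [x|||x [y [xX yX xy]]] := no_hole u1 u2.
- by move=> xA; apply/negP => /dis/negP.
- by rewrite size_take_min; move: sX; clear; lia.
- by rewrite size_drop; move: sX; clear; lia.
by exists x, y; rewrite (mem_take xX) (mem_drop yX).
Qed.

(** Greedy choice: at each step at most 17 vertices are to be avoided, leaving at
least k + 1 = a + b neighbours, among which there is an edge. *)
Lemma disjoint_triangles (xs Y : seq T) : size Y + 2 * size xs <= 19 ->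
  exists L, [/\ unzip1 L = xs, {in L, forall q, cycle e [:: q.1; q.2.1; q.2.2]},
    uniq (ends (unzip2 L)) & {in ends (unzip2 L), forall y, y \notin Y}].
Proof.
elim: xs Y => [|x xs IH] Y sY; first by exists [::].
pose N := [seq y <- enum T | e x y && (y \notin Y)].
have [||y [z [yN zN yz]]] := @arc_inside N.
- by rewrite filter_uniq ?enum_uniq.
- rewrite size_filter.
  by have := leq_trans (deg18 x) (count_avoid Y (e x)); move: sY a_gt0 => /=; clear; lia.
move: yN; rewrite mem_filter mem_enum andbT => /andP[xy yY].
move: zN; rewrite mem_filter mem_enum andbT => /andP[xz zY].
have [|L [L1 eL uL LY]] := IH ([:: y; z] ++ Y); first by move: sY => /=; clear; lia.
exists ((x, (y, z)) :: L); split; first by rewrite /= L1.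
- by move=> q; rewrite inE => /predU1P[->|/eL//]; rewrite /= xy yz eC xz.
- rewrite /= -/(ends _) uL inE; have yz' : y != z by apply: contraTneq yz => ->; rewrite eI.
  rewrite (negPf yz') /= andbT; apply/andP; split; apply/negP => /LY.
    by rewrite !inE eqxx.
  by rewrite !inE eqxx orbT.
move=> t; rewrite /= !inE => /or3P[/eqP->//|/eqP->//|/LY].
by rewrite !inE !negb_or => /and3P[].
Qed.

Lemma triangle_uniq x y z : cycle e [:: x; y; z] -> uniq [:: x; y; z].
Proof.
move=> /= /and4P[xy yz zx _]; rewrite !inE !andbT negb_or -andbA; apply/and3P; split.
- by apply: contraTneq xy => ->; rewrite eI.
- by apply: contraTneq zx => ->; rewrite eI.
- by apply: contraTneq yz => ->; rewrite eI.
Qed.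

(** Disjoint triangles at v agree by [cycle_weight_triangles] for a 3-cycle; two
arbitrary ones are compared through a third disjoint from both. *)
Lemma triangle_parity v : exists c, forall y z,
  cycle e [:: v; y; z] -> odd (cycle_weight f [:: v; y; z]) = c.
Proof.
have flip y z y' z' : cycle e [:: v; y; z] -> cycle e [:: v; y'; z'] ->
    {in [:: y'; z'], forall t, t \notin [:: v; y; z]} ->
    odd (cycle_weight f [:: v; y; z]) = odd (cycle_weight f [:: v; y'; z']).
  move=> eyz eyz' dis; have := @cycle_weight_triangles y v z [::] [:: (v, (y', z'))].
  rewrite big_seq1 -[in RHS]/(cycle_weight f [:: v; y'; z']) => <- //.
  - by congr odd; rewrite /= (fC y v) (fC v z) (fC z y); clear; lia.
  - have := triangle_uniq eyz; have := triangle_uniq eyz'.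
    have := dis y' (mem_head _ _); have := dis z'; rewrite !inE eqxx orbT => /(_ isT).
    rewrite /= !inE !negb_or !andbT => /and3P[? ? ?] /and3P[? ? ?] /andP[/andP[? ?] ?] /andP[/andP[? ?] ?].
    rewrite (eq_sym y v) (eq_sym v y').
    by do ?[apply/andP; split]; rewrite // eq_sym.
  - by move: eyz => /= /and4P[? ? ? _]; rewrite !andbT (eC y) (eC v z) (eC z y); apply/and3P.
  - by move=> q; rewrite inE => /eqP->.
have [//|L0 [L0v eL0 _ _]] := @disjoint_triangles [:: v] [::].
case: L0 L0v eL0 => [//|[x [y0 z0]] [|//]] [xv] e0.
exists (odd (cycle_weight f [:: v; y0; z0])) => y z eyz.
have {x xv} e0 : cycle e [:: v; y0; z0] by rewrite -xv; apply: (e0 (x, (y0, z0))); rewrite mem_head.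
have [//|L1 [L1v eL1 _ dis]] := @disjoint_triangles [:: v] [:: v; y; z; y0; z0].
case: L1 L1v eL1 dis => [//|[x [y1 z1]] [|//]] [xv] e1 dis.
have {}e1 : cycle e [:: v; y1; z1] by rewrite -xv; apply: (e1 (x, (y1, z1))); rewrite mem_head.
rewrite (flip y z y1 z1) // ?(flip y0 z0 y1 z1) // => t /dis; rewrite !inE !negb_or;
  by case/and5P=> *; apply/and3P.
Qed.


(** * The parity is constant *)

Section ConstantParity.
Hypothesis deg2 : forall x, 2 * (a + b - 1) + 9 <= count (e x) (enum T).
Variable c : T -> bool.
Hypothesis cP : forall v y z, cycle e [:: v; y; z] -> odd (cycle_weight f [:: v; y; z]) = c v.

Lemma short_cycle_parity x1 x2 x3 r :
    uniq [:: x1, x2, x3 & r] -> cycle e [:: x1, x2, x3 & r] -> size r <= 4 ->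
  odd (cycle_weight f [:: x1, x2, x3 & r]) = odd (\sum_(x <- x2 :: r) c x).
Proof.
move=> uC eCr r4; have [|L [L1 eL uL dis]] := @disjoint_triangles (x2 :: r) [:: x1, x2, x3 & r].
  by move: r4 => /=; clear; lia.
rewrite (cycle_weight_triangles _ eCr L1 eL r4).
  rewrite -L1 big_map; elim: L eL {L1 uL dis} => [|q L IH] eL; first by rewrite !big_nil.
  rewrite !big_cons oddD (oddD (c _)) cP ?eL ?mem_head // IH ?oddb // => l lL.
  by rewrite eL // inE lL orbT.
by rewrite cat_uniq uC uL andbT; apply/hasPn => y /dis.
Qed.

Lemma parity_triangle x y z : e x y -> e x z -> e y z -> c x = c y.
Proof.
move=> xy xz yz; rewrite -(cP (v := x) (y := y) (z := z)) /= ?xy ?yz ?(eC z) ?xz //.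
rewrite -(cP (v := y) (y := z) (z := x)) /= ?xy ?yz ?(eC z) ?xz //.
by congr odd; clear; lia.
Qed.

(** Without a common neighbour, v and w lie on a 5-cycle v x y z w: fewer than a
neighbours of v have no neighbour in N(w), so at least a + b of them do, and these
span an edge xy. Evaluating the parity of the 5-cycle from two starting points gives
c(x) + c(z) + c(w) = c(z) + c(v) + c(x). *)
Lemma parity_edge v w : e v w -> c v = c w.
Proof.
move=> vw; have [/hasP[u _ /andP[vu wu]]|/hasPn no_nbr] :=
  boolP (has (fun u => e v u && e w u) (enum T)).
  exact: parity_triangle vw vu wu.
pose nbrs x z := [seq y <- enum T | e x y && (y \notin [:: z])].
have uN x z : uniq (nbrs x z) by rewrite filter_uniq ?enum_uniq.
have memN x z y : (y \in nbrs x z) = e x y && (y != z).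
  by rewrite mem_filter mem_enum andbT inE.
have sN x z : 2 * (a + b - 1) + 8 <= size (nbrs x z).
  rewrite size_filter.
  by have := leq_trans (deg2 x) (count_avoid [:: z] (e x)); rewrite /=; clear; lia.
pose linked y := has (e y) (nbrs w v).
have few : count (predC linked) (nbrs v w) < a.
  rewrite ltnNge -size_filter; apply/negP => many.
  have [|||||x [y [xA yB xy]]] := @no_hole (filter (predC linked) (nbrs v w)) (nbrs w v) => //.
  - by rewrite filter_uniq.
  - move=> x; rewrite mem_filter memN => /and3P[_ vx _].
    by rewrite memN; apply/negP => /andP[wx _]; have := no_nbr x; rewrite mem_enum vx wx => /(_ isT).
  - by apply: leq_trans (sN w v); move: a_gt0; clear; lia.
  move: xA; rewrite mem_filter => /andP[/hasPn/(_ y yB)].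
  by rewrite xy.
have [||x [y [xA yA xy]]] := @arc_inside (filter linked (nbrs v w)).
- by rewrite filter_uniq.
- have := count_predC linked (nbrs v w); have := sN v w.
  by rewrite size_filter; move: few a_gt0 b_gt0; clear; lia.
move: xA; rewrite mem_filter memN => /and3P[_ vx xw].
move: yA; rewrite mem_filter memN => /and3P[/hasP[z zB yz] vy yw].
move: zB; rewrite memN => /andP[wz zv].
have ne s t : e s t -> s != t by apply: contraTneq => ->; rewrite eI.
have xz : x != z.
  by apply: contraTneq wz => <-; apply/negP => wx; have := no_nbr x; rewrite mem_enum vx wx => /(_ isT).
pose C := [:: v; x; y; z; w].
have uC : uniq C.
  rewrite /= !inE !negb_or !andbT (ne _ _ vx) (ne _ _ vy) (eq_sym v z) zv (ne _ _ vw).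
  by rewrite (ne _ _ xy) xz xw (ne _ _ yz) yw eq_sym (ne _ _ wz).
have eCy : cycle e C by rewrite /= vx xy yz (eC z) wz (eC w) vw.
have p1 := short_cycle_parity uC eCy isT.
have p2 : odd (cycle_weight f (rot 2 C)) = odd (\sum_(u <- [:: z; v; x]) c u).
  have uC2 : uniq (rot 2 C) by rewrite rot_uniq.
  have eC2 : cycle e (rot 2 C) by rewrite rot_cycle.
  exact: (short_cycle_parity uC2 eC2).
move: p1 p2; rewrite cycle_weight_rot => -> ; rewrite !big_cons !big_nil.
by case: (c v) (c w) (c x) (c z) => [] [] [] [].
Qed.

(** Disjoint neighbourhoods of u and v are joined by an edge. *)
Lemma short_walk u v : exists m, path e u (rcons m v) && (size m <= 2).
Proof.
have [/hasP[x _ /andP[ux vx]]|/hasPn no_nbr] :=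
  boolP (has (fun x => e u x && e v x) (enum T)).
  by exists [:: x]; rewrite /= ux (eC x) vx.
have [|||||x [y [xA yB xy]]] := @no_hole (filter (e u) (enum T)) (filter (e v) (enum T)).
- by rewrite filter_uniq ?enum_uniq.
- by rewrite filter_uniq ?enum_uniq.
- move=> x; rewrite mem_filter mem_enum andbT => ux; rewrite mem_filter mem_enum andbT; have := no_nbr x.
  by rewrite mem_enum ux => /(_ isT).
- by rewrite size_filter; have := deg18 u; move: b_gt0; clear; lia.
- by rewrite size_filter; have := deg18 v; move: a_gt0; clear; lia.
exists [:: x; y]; move: xA; rewrite mem_filter => /andP[ux _].
move: yB; rewrite mem_filter => /andP[vy _].
by rewrite /= ux xy (eC y) vy.
Qed.

Lemma parity_constant u v : c u = c v.
Proof.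
have [m /andP[+ _]] := short_walk u v; elim: m u => [|x m IH] u /= /andP[ux].
  by rewrite (parity_edge ux).
by move/IH <-; apply: parity_edge.
Qed.

Variable r0 : T.

(** A closed walk that repeats a vertex splits there into two shorter ones. *)
Lemma short_closed_walk_parity s : cycle e s -> size s <= 7 ->
  odd (cycle_weight f s) = odd (size s) && c r0.
Proof.
have [n] := ubnP (size s); elim: n s => // n IH s; rewrite ltnS => sn es s7.
have [us|] := boolP (uniq s).
  case: s us es s7 {sn} => [|x [|y [|z r]]] us es s7 //.
  - by move: es; rewrite /= eI.
  - by rewrite /= (fC y x); move: (f x y); clear => k; lia.
  rewrite short_cycle_parity //.
  have -> t : odd (\sum_(u <- t) c u) = odd (size t) && c r0.
    elim: t => [|u t IHt]; first by rewrite big_nil.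
    by rewrite big_cons oddD oddb IHt (parity_constant u r0) /=; case: (c r0); case: odd.
  by rewrite /= !negbK.
have split_walk (t : seq T) : ~~ uniq t -> exists x p q r, t = p ++ [:: x & q] ++ [:: x & r].
  elim: t => //= x t IHt; rewrite negb_and negbK => /orP[/splitPr[q r]|/IHt[y [p [q [r ->]]]]].
    by exists x, [::], q, r.
  by exists y, (x :: p), q, r.
move=> /split_walk[x [p [q [r sE]]]].
have wE h : cycle_weight h s = cycle_weight h (x :: q) + cycle_weight h (x :: (r ++ p)).
  rewrite sE cycle_weight_catC -catA (cycle_weight_cat h x) //= !walk_weight_rcons.
  by rewrite addnA.
have sz : size s = size (x :: q) + size (x :: (r ++ p)).
  by rewrite sE !size_cat /= size_cat; clear; lia.
move: es; rewrite -cycle_weight0 wE addn_eq0 !cycle_weight0 => /andP[e1 e2].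
have s1 : 0 < size (x :: q) by []. have s2 : 0 < size (x :: (r ++ p)) by [].
by rewrite wE oddD !IH //; move: sn s7 s1 s2; rewrite sz; clear; lia.
Qed.

(** Weigh walks of length at most 3 from r0 to every vertex, correcting by c for each
step. For an edge uv, the walks to u and v close up to a walk of length at most 7,
whence the bound on the short cycles. *)
Lemma parity_potential : exists g : T -> bool, forall u v, e u v ->
  odd (f u v) = g u (+) g v (+) c r0.
Proof.
have [m mP] := fin_all_exists (short_walk r0).
exists (fun v => odd (walk_weight f r0 (rcons (m v) v)) (+) (~~ odd (size (m v)) && c r0)).
move=> u v uv; have /andP[pu su] := mP u; have /andP[pv sv] := mP v.
pose s := (r0 :: rcons (m u) u) ++ rev (rcons (m v) v).
have wE h : (forall x y, h x y = h y x) -> cycle_weight h s =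
    walk_weight h r0 (rcons (m u) u) + h u v + walk_weight h r0 (rcons (m v) v).
  move=> hC; rewrite (cycle_weight_cat h r0) // [last _ _]/= last_rcons [head _ _]/=.
  have := path_weight_rev hC (r0 :: rcons (m v) v).
  rewrite -rev_cons -rcons_cons rev_rcons /= => <-.
  by rewrite addnA.
have es : cycle e s.
  have := wE _ (nonarcC eC); rewrite /nonarc uv addn0.
  move: pu pv; rewrite -!(walk_weight0 e) => /eqP-> /eqP->.
  by move/eqP; rewrite cycle_weight0.
have sz : size s = size (m u) + size (m v) + 3.
  by rewrite size_cat size_rev /= !size_rcons; clear; lia.
have := short_closed_walk_parity es; rewrite sz (wE _ fC) !oddD.
have -> : size (m u) + size (m v) + 3 <= 7 by move: su sv; clear; lia.
by move=> /(_ isT); case: (odd (walk_weight f r0 (rcons (m u) u))) (odd (f u v))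
  (odd (walk_weight f r0 (rcons (m v) v))) (odd (size (m u))) (odd (size (m v))) (c r0) =>
  [] [] [] [] [] [].
Qed.

Lemma closed_walk_parity s : cycle e s -> odd (cycle_weight f s) = odd (size s) && c r0.
Proof.
have [g gP] := parity_potential; case: s => [//|x p] /=.
have walkP y q : path e y q ->
    odd (walk_weight f y q) = g y (+) g (last y q) (+) (odd (size q) && c r0).
  elim: q y => [|z q IH] y /=; first by rewrite addbb.
  case/andP=> /gP yz /IH zq; rewrite oddD yz zq.
  by case: (g y) (g z) (g (last z q)) (c r0) (odd (size q)) => [] [] [] [] [].
by move/walkP->; rewrite last_rcons size_rcons addbb.
Qed.

End ConstantParity.

(** Closed walks of length l have parity l c, and a Hamilton cycle has odd length but
even weight, so c = 0. *)
Theorem closed_walk_even (n_odd : odd #|T|)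
    (deg2 : forall x, 2 * (a + b - 1) + 9 <= count (e x) (enum T)) s :
  cycle e s -> ~~ odd (cycle_weight f s).
Proof.
have [c cP] := fin_all_exists triangle_parity.
case: s => [//|r0 p] es.
have [||||h [ph eh _]] := @hamilton_cycle_through T e a b eC eI a_gt0 b_gt0 no_hole
  [::] [::] (enum T) => //; first exact: enum_uniq.
  move=> x _; apply: leq_trans (leq_trans (deg18 x) _); first by rewrite leq_addr.
  by apply: sub_count => y /= ->.
have sh : size h = #|T| by rewrite (perm_size ph) -cardT.
have uh : uniq h by rewrite (perm_uniq ph) enum_uniq.
have := ham_even uh sh eh.
rewrite (closed_walk_parity deg2 cP r0 eh) (closed_walk_parity deg2 cP r0 es).
by rewrite sh n_odd /= => /negPf ->; rewrite andbF.
Qed.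

End ParityTransfer.

(** * Functionals on the edge space *)

Lemma cycle_weight_next (T : eqType) (h : T -> T -> nat) (s : seq T) : uniq s ->
  cycle_weight h s = \sum_(x <- s) h x (next s x).
Proof.
case: s => [|y p] /= uyp; first by rewrite big_nil.
suff nextE y0 z q : uniq (z :: q) ->
    walk_weight h z (rcons q y0) = \sum_(x <- z :: q) h x (next_at x y0 z q).
  exact: nextE.
elim: q z => [|t q IH] z /=; first by rewrite big_seq1 /= eqxx addn0.
case/andP=> zq /IH->; rewrite [RHS]big_cons /= eqxx; congr (_ + _).
apply: eq_big_seq => x xq /=; rewrite ifN //.
by apply: contraNneq zq => <-.
Qed.

(** If two vertices had the same edge to their successors, each would be the
successor of the other, which happens only on a cycle of length 2. Hence the edges
of a cycle are counted without repetition. *)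
Lemma next_pair_inj (T : finType) (s : seq T) : uniq s -> 2 < size s ->
  {in s &, injective (fun x => [set x; next s x])}.
Proof.
move=> us s3 x y xs _ /= exy; apply/eqP; apply: contraT => xy.
have := set21 x (next s x); rewrite exy in_set2 (negPf xy) => /eqP xny.
have := set21 y (next s y); rewrite -exy in_set2 eq_sym (negPf xy) => /eqP ynx.
have [i p sE] := rot_to xs.
have up : uniq (x :: p) by rewrite -sE rot_uniq.
have : next s (next s x) = x by rewrite -ynx -xny.
rewrite -!(next_rot i us) sE.
have : 2 < size (x :: p) by rewrite -sE size_rot.
case: p up {sE} => [|z [|t p]] //= /andP[]; rewrite !inE !negb_or eqxx => /and3P[xz xt _] _ _.
by rewrite eq_sym (negPf xz) eqxx => tx; rewrite tx eqxx in xt.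
Qed.

Section Parity.
Local Open Scope ring_scope.

Lemma natr_F2 n : (n%:R == 0 :> 'F_2) = ~~ odd n.
Proof. by rewrite -(dvdn_pcharf (pchar_Fp (isT : prime 2))) dvdn2. Qed.

Lemma F2_indicator (u : 'F_2) : u = (u != 0)%:R.
Proof. by case: u => [[|[|[]]] //] i; apply/val_inj. Qed.

End Parity.

Section CycleSpace.
Local Open Scope ring_scope.
Variable G : sgraph.

Lemma incidence_sum (F : {set {set G}}) :
  incidence F = \sum_(A in F) incidence [set A].
Proof.
apply/ffunP => A; rewrite sum_ffunE ffunE.
under eq_bigr => B _ do rewrite ffunE in_set1.
have [AF|AF] := boolP (val A \in F).
  rewrite (bigD1 (val A)) //= eqxx big1 ?addr0 // => B /andP[_].
  by rewrite eq_sym => /negPf->.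
by rewrite big1 // => B BF; case: eqP AF => // ->; rewrite BF.
Qed.

Lemma min_degree_le (x : G) : (min_degree G <= degree x)%N.
Proof.
rewrite /min_degree; have := mem_index_enum x.
elim: (index_enum _) => //= y r IH; rewrite big_cons inE => /predU1P[<-|/IH].
  exact: geq_minl.
by move=> le; apply: leq_trans (geq_minr _ _) le.
Qed.

Lemma degree_count (x : G) : degree x = count (adj x) (enum G).
Proof.
have uN : uniq [seq y <- enum G | adj x y] by rewrite filter_uniq ?enum_uniq.
rewrite -size_filter /degree cardsE -(card_uniqP uN).
by apply: eq_card => y; rewrite mem_filter mem_enum andbT.
Qed.

(** Some coordinate of the projection of w to a complement of U is nonzero; this
coordinate is the functional. *)
Lemma separating_functional (U : {vspace edge_space G}) (w : edge_space G) :
  w \notin U -> exists phi : edge_space G -> 'F_2,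
  [/\ {morph phi : u v / u + v}, phi 0 = 0, {in U, forall u, phi u = 0} & phi w != 0].
Proof.
move=> wU; have [d dw] : exists d, (w - projv U w) d != 0.
  apply/existsP; apply: contraR wU; rewrite negb_exists => /forallP w0.
  have -> : w = projv U w; last exact: memv_proj.
  apply/eqP; rewrite -subr_eq0; apply/eqP/ffunP => d.
  by have /negPn/eqP-> := w0 d; rewrite ffunE.
exists (fun u => (u - projv U u) d); split=> //.
- by move=> u v; rewrite linearD opprD addrACA ffunE.
- by rewrite linear0 subrr ffunE.
- by move=> u uU; rewrite projv_id // subrr ffunE.
Qed.

End CycleSpace.

Theorem theorem1p10 (n : nat) (G : sgraph) (cardG : #|G| = n) (n_odd : odd n)
  (deg_ge : maxn (2 * bip_indep_number G + 9) (bip_indep_number G + 18)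
            <= min_degree G) :
  cycle_space_of_length G n = cycle_space G.
Proof.
apply/eqP; rewrite eqEsubv; apply/andP; split.
  apply: sub_span => v /mapP[F]; rewrite mem_enum => /imsetP[s]; rewrite inE => cs -> ->.
  by apply/mapP; exists (cycle_edges s); rewrite ?mem_enum //; apply/all_cyclesP; exists s.
apply/span_subvP => v /mapP[F]; rewrite mem_enum => /all_cyclesP[s cs ->] ->.
apply: contraT => sU; have [phi [phiD phi0 phiU phis]] := separating_functional sU.
pose f x y : nat := phi (incidence [set [set x; y]]) != 0%R.
have phi_cycle t : is_cycle t -> phi (incidence (cycle_edges t)) = ((cycle_weight f t)%:R)%R.
  case/andP=> t2 /andP[_ ut]; rewrite incidence_sum (big_morph phi phiD phi0).
  rewrite big_imset /=; last exact: next_pair_inj.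
  rewrite (cycle_weight_next f ut) natr_sum -big_uniq //.
  by apply: eq_bigr => x _; apply: F2_indicator.
have deg x : (bip_indep_number G + 18 <= count (adj x) (enum G) /\
    2 * bip_indep_number G + 9 <= count (adj x) (enum G)).
  have := leq_trans deg_ge (min_degree_le x).
  by rewrite geq_max degree_count => /andP[].
have s3 : (2 < size s) by case/andP: cs.
have G3 : (2 < #|G|).
  case/andP: cs => _ /andP[_ us]; apply: leq_trans s3 _.
  by rewrite -(card_uniqP us) max_card.
have fC x y : f x y = f y x by rewrite /f setUC.
have ham_even t : uniq t -> size t = #|G| -> cycle (@adj G) t -> ~~ odd (cycle_weight f t).
  move=> ut st et; have ct : is_cycle t by rewrite /is_cycle st G3 /ucycleb et ut.
  rewrite -natr_F2 -phi_cycle // phiU //; apply: memv_span.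
  apply/mapP; exists (cycle_edges t) => //; rewrite mem_enum; have tn : size t == n by rewrite st cardG.
  by apply/imsetP; exists (Tuple tn); rewrite ?inE.
have [a [b [a0 b0 abk bip]]] : exists a b : nat, [/\ 0 < a, 0 < b,
    a + b = (bip_indep_number G).+1 & forall A B : {set G}, B \subset ~: A ->
    #|A| = a -> #|B| = b -> exists x y, [/\ x \in A, y \in B & adj x y]].
  by apply/bip_indep_boundP; rewrite /bip_indep_number; case: ex_minnP.
have no_hole (A B : seq G) : uniq A -> uniq B -> (forall x, x \in A -> x \notin B) ->
    (a <= size A) -> (b <= size B) -> exists x y, [/\ x \in A, y \in B & adj x y].
  move=> uA uB dis aA bB.
  have [||| x [y []]] := bip [set x in take a A] [set y in take b B].
  - apply/subsetP => x; rewrite !inE => /mem_take xB; apply/negP => /mem_take /dis.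
    by rewrite xB.
  - by rewrite cardsE (card_uniqP (take_uniq _ uA)) size_takel.
  - by rewrite cardsE (card_uniqP (take_uniq _ uB)) size_takel.
  by rewrite !inE => /mem_take xA /mem_take yB xy; exists x, y.
have kE : (a + b - 1 = bip_indep_number G) by rewrite abk subn1.
have := @closed_walk_even G (@adj G) a b f (@adj_sym G) (@adj_irrefl G) a0 b0 no_hole _ fC
  ham_even _ _ s.
rewrite kE cardG => even; have {even} := even (fun x => (deg x).1) n_odd (fun x => (deg x).2).
case/andP: (cs) => _ /andP[es _] /(_ es); rewrite -natr_F2 -phi_cycle // => /eqP ph.
by rewrite ph eqxx in phis.
Qed.
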